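(* Every finite bipartite series-parallel graph $G$ with bipartition classes $U,W$ satisfies Frankl's conjecture: if $G$ has at least one edge, then each of $U$ and $W$ contains a vertex belonging to at most half of the maximal stable sets of $G$.
   Context: A graph is series-parallel if it does not contain $K_4$ as a minor. A set of vertices is stable if no two are adjacent; maximal means maximal under inclusion. (Edgeless graphs are considered to satisfy Frankl's conjecture trivially.) *)

(* Defs.v *)
From mathcomp Require Import all_boot.

Set Implicit Arguments.
Unset Strict Implicit.
Unset Printing Implicit Defensive.

Definition simple_graph (T : finType) (e : rel T) : Prop :=
  symmetric e /\ irreflexive e.

Definition stable (T : finType) (e : rel T) (A : {set T}) : bool :=
  [forall x in A, forall y in A, ~~ e x y].

Definition max_stable_sets (T : finType) (e : rel T) : {set {set T}} :=
  [set A | maxset (stable e) A].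

Definition connected_in (T : finType) (e : rel T) (X : {set T}) : Prop :=
  X != set0 /\
  {in X &, forall x y, connect [rel u v | [&& u \in X, v \in X & e u v]] x y}.

(* B i is the branch set contracted to the vertex i of h. *)
Definition has_minor (T S : finType) (e : rel T) (h : rel S) : Prop :=
  exists B : S -> {set T},
    [/\ forall i, connected_in e (B i),
        forall i j, i != j -> [disjoint B i & B j]
      & forall i j, h i j -> exists x y, [/\ x \in B i, y \in B j & e x y]].

Definition complete_graph (n : nat) : rel 'I_n := [rel i j | i != j].
Arguments complete_graph n : clear implicits.

Definition series_parallel (T : finType) (e : rel T) : Prop :=
  ~ has_minor e (complete_graph 4).

Definition bipartition (T : finType) (e : rel T) (U W : {set T}) : Prop :=
  [/\ U :|: W = [set: T], [disjoint U & W], stable e U & stable e W].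

Definition in_at_most_half (T : finType) (e : rel T) (v : T) : Prop :=
  2 * #|[set A in max_stable_sets e | v \in A]| <= #|max_stable_sets e|.

Definition satisfies_Frankl (T : finType) (e : rel T) (U W : {set T}) : Prop :=
  (exists x y, e x y) ->
  (exists2 u, u \in U & in_at_most_half e u) /\
  (exists2 w, w \in W & in_at_most_half e w).

(* Main.v *)
(* A vertex of [U] is sought, the other side being symmetric. If [w] in [W] has
   neighbours [y1], [y2] with N(N(w)) contained in N(y1) u N(y2), then a maximal
   stable set [A] containing both [y1] and [y2] contains N(w), hence can be
   recovered from the maximal stable set generated by [A :&: W] and [w], which
   contains neither. Counting shows that [y1] or [y2] lies in at most half of the
   maximal stable sets.

   Such a [w] exists: let [D] be a minimal subset of [U] such that every N(u) with
   [u] in [U] is contained in N(d) for some [d] in [D]. It suffices that some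
   non-isolated [w] in [W] has at most two neighbours in [D]. Otherwise contract
   each vertex of [D] of degree 2 into one of its neighbours: since the
   neighbourhoods of [D] form an antichain, the result is a simple graph of minimum
   degree at least 3, and such a graph has a K4 minor. *)

Require Import Defs.
From mathcomp Require Import all_boot zify.

Set Implicit Arguments.
Unset Strict Implicit.
Unset Printing Implicit Defensive.

(** * Maximal stable sets of a bipartite graph and a criterion for a rare vertex *)

Section RareVertex.

Variables (T : finType) (e : rel T) (U W : {set T}).
Hypotheses (simple_e : simple_graph e) (bip : bipartition e U W).

Let e_sym : symmetric e. Proof. by case: simple_e. Qed.

Lemma bipartition_cover x : (x \in U) || (x \in W).
Proof. by case: bip => UW _ _ _; rewrite -in_setU UW inE. Qed.

Lemma bipartition_notinW x : x \in U -> x \notin W.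
Proof. by case: bip => _ /disjointFr UW _ _ /UW ->. Qed.

Lemma bipartition_edge x y : e x y -> (x \in U) = (y \in W).
Proof.
move=> exy; case: bip => _ _ /forall_inP sU /forall_inP sW.
have := bipartition_cover x; have := bipartition_cover y.
case: (boolP (x \in U)) => [xU|_] /=.
  by case: (boolP (y \in U)) => //= yU; have /forall_inP/(_ y yU) := sU x xU; rewrite exy.
move=> _ xW; apply/esym/negbTE/negP=> yW.
by have /forall_inP/(_ y yW) := sW x xW; rewrite exy.
Qed.

Lemma max_stableP (A : {set T}) :
  reflect ({in A &, forall x y, ~~ e x y} /\
           forall x, x \notin A -> exists2 y, y \in A & e x y)
          (A \in max_stable_sets e).
Proof.
have [_ e_irr] := simple_e.
rewrite inE; apply: (iffP maxsetP) => -[].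
  move=> /forall_inP stA maxA; split=> [x y xA yA|x xA].
    by have /forall_inP/(_ y yA) := stA x xA.
  case: (boolP [exists y in A, e x y]) => [/exists_inP[y]|]; first by exists y.
  rewrite negb_exists_in => /forall_inP nx.
  have /maxA : stable e (x |: A).
    apply/forall_inP=> y /setU1P[->|yA]; apply/forall_inP=> z /setU1P[->|zA].
    - by rewrite e_irr.
    - exact: nx.
    - by rewrite e_sym nx.
    - by have /forall_inP/(_ z zA) := stA y yA.
  by move=> /(_ (subsetU1 _ _)) xAA; rewrite -xAA setU11 in xA.
move=> stA maxA; split.
  by apply/forall_inP=> x xA; apply/forall_inP=> y yA; apply: stA.
move=> B /forall_inP stB AB; apply/eqP; rewrite eqEsubset AB andbT.
apply/subsetP=> x xB; apply/negPn/negP=> /maxA[y /(subsetP AB) yB exy].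
by have /forall_inP/(_ y yB) := stB x xB; rewrite exy.
Qed.

(** A vertex of [W] missing from a maximal stable set has a neighbour in its [U]-part, so the
    [U]-part determines the whole set. *)
Lemma max_stable_eqU (A B : {set T}) :
  A \in max_stable_sets e -> B \in max_stable_sets e ->
  A :&: U = B :&: U -> A = B.
Proof.
suff sub (A' B' : {set T}) : A' \in max_stable_sets e -> B' \in max_stable_sets e ->
    A' :&: U = B' :&: U -> A' \subset B'.
  by move=> mA mB AB; apply/eqP; rewrite eqEsubset !sub.
move=> /max_stableP[stA _] /max_stableP[_ maxB] /setP AB.
apply/subsetP=> x xA; apply/negPn/negP=> xB; have [y yB exy] := maxB x xB.
have := AB x; have := AB y; rewrite !inE xA (negbTE xB) yB /= => yU xU.
have yW : y \in W = false by rewrite -(bipartition_edge exy).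
move: yU; have := bipartition_cover y; rewrite yW orbF => ->; rewrite andbT => yA.
by have := stA x y xA yA; rewrite exy.
Qed.

(* The maximal stable set generated by [w] and [A :&: W]. *)
Definition push_stable (w : T) (A : {set T}) : {set T} :=
  let L := [set u in A :&: U | ~~ e w u] in
  L :|: [set x in W | [forall u in L, ~~ e u x]].

Lemma push_stable_U w A :
  push_stable w A :&: U = [set u in A :&: U | ~~ e w u].
Proof.
apply/setP=> x; rewrite !inE; case: (boolP (x \in U)) => xU; last by rewrite !andbF.
by rewrite (negbTE (bipartition_notinW xU)) orbF andbT.
Qed.

(** A deleted vertex of [A :&: U] is blocked by [w], which belongs to the new set. A vertex of [U]
    outside [A] keeps its blocking neighbour from [A], because the [U]-part has only shrunk. *)
Lemma push_stable_max w A : w \in W ->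
  A \in max_stable_sets e -> push_stable w A \in max_stable_sets e.
Proof.
move=> wW /max_stableP[stA maxA].
set B := push_stable w A; set L := [set u in A :&: U | ~~ e w u].
have BU x : x \in U -> (x \in B) = (x \in L).
  by move=> xU; have /setP/(_ x) := push_stable_U w A; rewrite in_setI xU andbT.
have BW x : x \in W -> (x \in B) = [forall u in L, ~~ e u x].
  move=> xW; have xU : x \notin U by apply: contraL xW => /bipartition_notinW.
  by rewrite !inE (negbTE xU) xW andbF.
apply/max_stableP; split=> [x y xB yB|x].
  apply/negP=> exy.
  wlog xU : x y xB yB exy / x \in U.
    move=> hw; case/orP: (bipartition_cover x) => [xU|xW]; first exact: (hw x y).
    by apply: (hw y x) => //; rewrite 1?e_sym // (bipartition_edge (y := x)) // e_sym.
  have yW : y \in W by rewrite -(bipartition_edge exy).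
  by move: yB; rewrite BW // => /forall_inP/(_ x); rewrite exy -BU // => /(_ xB).
case/orP: (bipartition_cover x) => [xU|xW]; last first.
  rewrite BW // negb_forall_in => /exists_inP[u uL /negPn eux].
  exists u; last by rewrite e_sym.
  by rewrite BU //; move: uL; rewrite !inE => /andP[/andP[]].
rewrite BU // !inE xU andbT negb_and negbK; case: (boolP (x \in A)) => /= [xA ewx|xA _].
  exists w; last by rewrite e_sym.
  by rewrite BW //; apply/forall_inP=> u; rewrite !inE e_sym => /andP[].
have [y yA exy] := maxA x xA; exists y => //.
rewrite BW; last by rewrite -(bipartition_edge exy).
by apply/forall_inP=> u; rewrite !inE => /andP[/andP[uA _] _]; apply: stA.
Qed.

Lemma in_at_most_half_dominating w y1 y2 :
  w \in W -> e w y1 -> e w y2 ->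
  (forall u x, e w u -> e u x -> e y1 x || e y2 x) ->
  in_at_most_half e y1 \/ in_at_most_half e y2.
Proof.
move=> wW ey1 ey2 dom; pose M := max_stable_sets e.
pose M11 := [set A in M | (y1 \in A) && (y2 \in A)].
pose M10 := [set A in M | (y1 \in A) && (y2 \notin A)].
pose M01 := [set A in M | (y1 \notin A) && (y2 \in A)].
pose M00 := [set A in M | (y1 \notin A) && (y2 \notin A)].
have NU u : e w u -> u \in U by rewrite e_sym => /bipartition_edge->.
(* If [u] were missing, it would have a neighbour in [A]; by [dom] this neighbour is adjacent to
   [y1] or [y2], against stability. *)
have NA (A : {set T}) u : A \in M11 -> e w u -> u \in A.
  rewrite inE => /andP[/max_stableP[stA maxA] /andP[y1A y2A]] ewu.
  apply/negPn/negP=> /maxA[x xA eux]; have := dom u x ewu eux.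
  by rewrite (negbTE (stA _ _ y1A xA)) (negbTE (stA _ _ y2A xA)).
(* The push deletes exactly the neighbours of [w] from the [U]-part, and by [NA] they were all
   present. *)
have inj : {in M11 &, injective (push_stable w)}.
  move=> A B A11 B11 AB; apply: max_stable_eqU.
  - by case/setIdP: A11.
  - by case/setIdP: B11.
  have := push_stable_U w A; rewrite AB push_stable_U => /setP eqAB.
  apply/setP=> u; have := eqAB u; rewrite !inE.
  case: (boolP (e w u)) => [ewu _|_]; last by rewrite !andbT.
  by rewrite (NA A) // (NA B).
have le1100 : #|M11| <= #|M00|.
  rewrite -(card_in_imset inj); apply/subset_leq_card/subsetP=> B /imsetP[A].
  rewrite inE => /andP[AM _] ->; rewrite inE push_stable_max //=.
  have pushF y : e w y -> y \notin push_stable w A.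
    move=> ewy; have /setP/(_ y) := push_stable_U w A.
    by rewrite in_setI (NU y) // andbT => ->; rewrite !inE ewy andbF.
  by rewrite !pushF.
have split (P Q : pred {set T}) :
    #|[set A in M | P A]| = #|[set A in M | P A && Q A]| + #|[set A in M | P A && ~~ Q A]|.
  rewrite -(cardsID [set A | Q A]); congr (_ + _); apply: eq_card => A; rewrite !inE.
    by rewrite andbA.
  by rewrite andbC -andbA.
have M1 := split (fun A => y1 \in A) (fun A => y2 \in A).
have M2 := split (fun A => y2 \in A) (fun A => y1 \in A).
have M0 := split (fun A => y1 \notin A) (fun A => y2 \in A).
have MT := split predT (fun A => y1 \in A).
have MM : [set A in M | predT A] = M by apply/setP=> A; rewrite !inE andbT.
have E2 : [set A in M | (y2 \in A) && (y1 \in A)] = M11.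
  by apply/setP=> A; rewrite !inE [(y2 \in A) && _]andbC.
have E3 : [set A in M | (y2 \in A) && (y1 \notin A)] = M01.
  by apply/setP=> A; rewrite !inE [(y2 \in A) && _]andbC.
rewrite MM /= in MT; rewrite E2 E3 in M2.
rewrite -/M11 -/M10 in M1; rewrite -/M01 -/M00 in M0.
rewrite /in_at_most_half -/M.
(* Given [le1100], the rarer of the two vertices is the one that occurs without the other in fewer
   sets. *)
have [le10|/ltnW le01] := leqP #|M10| #|M01|; [left; rewrite M1 | right; rewrite M2].
  by rewrite MT M1 M0; move: #|M11| #|M10| #|M01| #|M00| le1100 le10; lia.
by rewrite MT M1 M0; move: #|M11| #|M10| #|M01| #|M00| le1100 le01; lia.
Qed.

End RareVertex.

Lemma ltn_cardsD1 (S : finType) (A : {set S}) x n : n < #|A| -> n <= #|A :\ x|.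
Proof. by rewrite (cardsD1 x); case: (x \in A) => // /ltnW. Qed.

(** * Minors represented by families of disjoint connected blocks *)

Section BlockFamilies.

Variables (T : finType) (e : rel T).
Hypothesis e_sym : symmetric e.

Definition restr (X : {set T}) : rel T := [rel u v | [&& u \in X, v \in X & e u v]].

(** A boolean form of [connected_in], usable in [all] and in a maximality argument. *)
Definition conn (X : {set T}) : bool :=
  (X != set0) && [forall x in X, forall y in X, connect (restr X) x y].

Lemma connP (X : {set T}) : reflect (connected_in e X) (conn X).
Proof.
apply: (iffP andP) => -[X0 cX]; split=> //.
  by move=> x y xX yX; have /forall_inP/(_ x xX)/forall_inP/(_ y yX) := cX.
by apply/forall_inP=> x xX; apply/forall_inP=> y yX; apply: cX.
Qed.

Lemma restr_sym (X : {set T}) : connect_sym (restr X).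
Proof.
by apply: sym_connect_sym => x y; rewrite /restr /= e_sym andbCA.
Qed.

Lemma connect_restrS (X Y : {set T}) x y :
  X \subset Y -> connect (restr X) x y -> connect (restr Y) x y.
Proof.
move=> /subsetP XY; apply: connect_sub => u v /and3P[uX vX euv].
by apply: connect1; rewrite /restr /= !XY.
Qed.

Lemma conn_from (X : {set T}) v :
  v \in X -> (forall x, x \in X -> connect (restr X) v x) -> conn X.
Proof.
move=> vX cv; apply/andP; split; first by apply/set0Pn; exists v.
apply/forall_inP=> x xX; apply/forall_inP=> y yX.
by apply: connect_trans (cv y yX); rewrite restr_sym cv.
Qed.

Lemma conn_star (X : {set T}) v :
  v \in X -> (forall x, x \in X -> x = v \/ e v x) -> conn X.
Proof.
move=> vX star; apply: (conn_from vX) => x xX.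
have [->|evx] := star x xX; first exact: connect0.
by apply: connect1; rewrite /restr /= vX xX.
Qed.

Definition adj (X Y : {set T}) : bool := [exists x in X, exists y in Y, e x y].

Lemma adjP (X Y : {set T}) : reflect (exists x y, [/\ x \in X, y \in Y & e x y]) (adj X Y).
Proof.
apply: (iffP exists_inP) => [[x xX /exists_inP[y yY exy]]|[x [y [xX yY exy]]]].
  by exists x, y.
by exists x => //; apply/exists_inP; exists y.
Qed.

Lemma adj_sym (X Y : {set T}) : adj X Y = adj Y X.
Proof.
by apply/adjP/adjP => -[x [y [xX yY exy]]]; exists y, x; rewrite e_sym.
Qed.

Lemma adjUr (X Y Z : {set T}) : adj X (Y :|: Z) = adj X Y || adj X Z.
Proof.
apply/adjP/orP => [[x [y [xX /setUP[yY|yZ] exy]]]|].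
- by left; apply/adjP; exists x, y.
- by right; apply/adjP; exists x, y.
by case=> /adjP[x [y [xX yY exy]]]; exists x, y; rewrite inE yY ?orbT.
Qed.

Lemma connU (X Y : {set T}) : conn X -> conn Y -> adj X Y -> conn (X :|: Y).
Proof.
move=> /connP[_ cX] /connP[_ cY] /adjP[x [y [xX yY exy]]].
apply: (@conn_from _ x) => [|z]; first by rewrite inE xX.
case/setUP=> [zX|zY]; first by apply: connect_restrS (cX _ _ xX zX); apply: subsetUl.
apply: connect_trans (connect_restrS (subsetUr X Y) (cY _ _ yY zY)).
by apply: connect1; rewrite /restr /= !inE xX yY exy orbT.
Qed.

(* The blocks play the role of the vertices of a minor of [e], so that contracting
   an edge replaces two blocks by their union. *)
Definition block_family (P : {set {set T}}) : Prop :=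
  {in P, forall X : {set T}, conn X} /\
  {in P &, forall X Y : {set T}, X != Y -> [disjoint X & Y]}.

(** The condition [Y != X] removes loops: a block containing an edge is [adj] to itself. *)
Definition nb (P : {set {set T}}) (X : {set T}) : {set {set T}} :=
  [set Y in P | (Y != X) && adj X Y].

Lemma nb_sym (P : {set {set T}}) (X Y : {set T}) :
  X \in P -> Y \in P -> (X \in nb P Y) = (Y \in nb P X).
Proof. by move=> XP YP; rewrite !inE XP YP eq_sym adj_sym. Qed.

Lemma block_familyS (P Q : {set {set T}}) :
  Q \subset P -> block_family P -> block_family Q.
Proof.
by move=> /subsetP QP [cP dP]; split=> [X /QP/cP|X Y /QP XP /QP YP]; last exact: dP.
Qed.

(** Disjointness and adjacency are symmetric, so the six pairs in increasing order suffice. *)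
Lemma K4_minor_of_blocks (A B C D : {set T}) :
  all conn [:: A; B; C; D] ->
  pairwise (fun X Y : {set T} => [disjoint X & Y] && adj X Y) [:: A; B; C; D] ->
  has_minor e (complete_graph 4).
Proof.
move=> cs /(pairwiseP set0) pw; exists (fun i : 'I_4 => nth set0 [:: A; B; C; D] i).
have ltP (i j : 'I_4) : i != j -> (i < j) || (j < i) by rewrite -neq_ltn.
split=> [i|i j /ltP|i j /ltP].
- by apply/connP/(allP cs)/mem_nth; case: i.
- by case/orP=> /pw; rewrite !inE /= !ltn_ord => /(_ isT isT)/andP[] //; rewrite disjoint_sym.
- case/orP=> /pw; rewrite !inE /= !ltn_ord => /(_ isT isT)/andP[_]; last rewrite adj_sym.
    by move/adjP.
  by move/adjP.
Qed.

Definition contract (P : {set {set T}}) (B C : {set T}) : {set {set T}} :=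
  (B :|: C) |: (P :\ B :\ C).

(** * Degrees under contraction of an edge between blocks *)

Section Contract.

Variables (P : {set {set T}}) (B C : {set T}).
Hypotheses (famP : block_family P) (BP : B \in P) (CP : C \in nb P B).

Let CP' : C \in P. Proof. by case/setIdP: CP. Qed.
Let CB : C != B. Proof. by case/setIdP: CP => _ /andP[]. Qed.

Lemma disjoint_contract (X : {set T}) : X \in P :\ B :\ C -> [disjoint X & B :|: C].
Proof.
have [_ dP] := famP; rewrite !inE => /and3P[XC XB XP].
by rewrite -setI_eq0 setIUr setU_eq0 !setI_eq0 !dP.
Qed.

Lemma neq_contract (X : {set T}) : X \in P :\ B :\ C -> X != B :|: C.
Proof.
move=> XP; have [cP _] := famP.
have /cP/andP[/set0Pn[x xX] _] : X \in P by move: XP; rewrite !inE => /and3P[].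
apply: contraTneq (disjoint_contract XP) => XE.
by rewrite -XE -setI_eq0 setIid; apply/set0Pn; exists x.
Qed.

Lemma block_family_contract : block_family (contract P B C).
Proof.
have [cP dP] := famP; split=> [X|X Y].
  case/setU1P=> [->|]; last by rewrite !inE => /and3P[_ _ /cP].
  by apply: connU; rewrite ?cP //; case/setIdP: CP => _ /andP[].
case/setU1P=> [->|XP] /setU1P[->|YP]; rewrite ?eqxx // => XY.
- by rewrite disjoint_sym disjoint_contract.
- exact: disjoint_contract.
- by move: XP YP; rewrite !inE => /and3P[_ _ XP] /and3P[_ _ YP]; apply: dP.
Qed.

Lemma card_contract : #|contract P B C| < #|P|.
Proof.
rewrite cardsU1 (cardsD1 B P) BP (cardsD1 C (P :\ B)).
have -> : C \in P :\ B by rewrite !inE CB CP'.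
by rewrite !ltnS leq_add2r leq_b1.
Qed.

(** Sending [B] and [C] to their union can identify two neighbours of [X] only if both are
    neighbours of [X]. *)
Lemma card_nb_contract (X : {set T}) : X \in P :\ B :\ C ->
  ~~ ((B \in nb P X) && (C \in nb P X)) ->
  #|nb P X| <= #|nb (contract P B C) X|.
Proof.
move=> XP nBC; pose f Y := if (Y == B) || (Y == C) then B :|: C else Y.
have f_old Y : Y \in nb P X -> ~~ ((Y == B) || (Y == C)) -> Y != B :|: C.
  rewrite inE negb_or => /andP[YP _] /andP[YB YC].
  by apply: neq_contract; rewrite !inE YB YC YP.
have inj : {in nb P X &, injective f}.
  move=> Y Z YX ZX; rewrite /f.
  case: ifP => YE; case: ifP => ZE // E; last first.
  - by have := f_old _ YX (negbT YE); rewrite E eqxx.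
  - by have := f_old _ ZX (negbT ZE); rewrite E eqxx.
  case/orP: YE YX ZX => /eqP->; case/orP: ZE => /eqP-> // b c; move: nBC.
    by rewrite b c.
  by rewrite b c.
rewrite -(card_in_imset inj); apply/subset_leq_card/subsetP=> _ /imsetP[Y YX ->].
move: (YX); rewrite inE => /and3P[YP YnX aXY]; rewrite /f; case: ifP => YE.
  rewrite !inE eqxx /= eq_sym neq_contract //= adjUr.
  by case/orP: YE aXY => /eqP-> ->; rewrite ?orbT.
have /norP[YB YC] := negbT YE.
by rewrite !inE YP YnX aXY YB YC orbT.
Qed.

(** A common neighbour of [B] and [C] loses just one neighbour, so degree 4 is enough to stay at
    3. *)
Lemma card_nb_contract_pred (X : {set T}) : X \in P :\ B :\ C ->
  3 < #|nb P X| -> 3 <= #|nb (contract P B C) X|.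
Proof.
move=> XP lt3; have lt3' : 3 <= #|nb P X :\ B|.
  exact: ltn_cardsD1.
have [/andP[BX CX]|nBC] := boolP ((B \in nb P X) && (C \in nb P X)); last first.
  exact: leq_trans (ltnW lt3) (card_nb_contract XP nBC).
have aXB : adj X B by case/setIdP: BX => _ /andP[].
apply: leq_trans (_ : #|(B :|: C) |: (nb P X :\ B :\ C)| <= _).
  rewrite cardsU1; set b := _ \notin _; have -> : b.
    rewrite /b !inE; apply/negP=> /and4P[n1 n2 n3 _].
    by have := @neq_contract (B :|: C); rewrite !inE n1 n2 n3 eqxx => /(_ isT).
  by apply: leq_trans lt3' _; rewrite (cardsD1 C (_ :\ B)) leq_add2r leq_b1.
apply/subset_leq_card/subsetP=> Y /setU1P[->|].
  by rewrite !inE eqxx /= eq_sym neq_contract //= adjUr aXB.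
by rewrite !inE => /and5P[-> -> -> -> ->]; rewrite orbT.
Qed.

End Contract.

(* The root [a] is exempt from the degree bound so that blocks can be contracted
   into it. This fails only at a triangle [a, y, z] with [z] of degree 3; applied
   twice, it yields adjacent [z], [z'] with neighbourhoods [a, z', t] and [a, z, t'].
   If [t != t'], contract [z] and [z']. If [t = t'], let [D] be the component of [t]
   avoiding [a, z, z']: either [a, z, z', D] form a K4, or [D] with root [t] is a
   smaller instance. *)
Lemma K4_minor_of_rooted_min_degree (P : {set {set T}}) (a : {set T}) :
  block_family P -> a \in P -> 1 < #|P| ->
  {in P, forall X : {set T}, X != a -> 3 <= #|nb P X|} ->
  has_minor e (complete_graph 4).
Proof.
(* The induction is on the number of blocks, with the root generalised since it may change. *)
have [n] := ubnP #|P|; elim: n P a => // n IHn P a /ltnSE leP famP aP gt1 degP.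
have [cP dP] := famP.
have nbP X Y : Y \in nb P X -> [/\ Y \in P, Y != X & adj X Y].
  by rewrite inE => /and3P.
(* An isolated root is discarded: no other degree changes, and any remaining block can be the new
   root. *)
have [nba0|[x xa]] := set_0Vmem (nb P a).
  have subP : P :\ a \subset P by apply: subD1set.
  have nbE X : X \in P :\ a -> nb (P :\ a) X = nb P X.
    case/setD1P=> Xa XP; apply/setP=> Y; rewrite !inE.
    have [->|//] := eqVneq Y a; have := nb_sym aP XP; rewrite nba0 !inE aP /=.
    by move=> ->.
  have [b bP] : exists b, b \in P :\ a.
    by apply/set0Pn; rewrite -card_gt0; move: gt1; rewrite (cardsD1 a) aP.
  have /setD1P[ba bP'] := bP.
  apply: (IHn (P :\ a) b) => //.
  - by apply: leq_trans leP; rewrite [X in _ < X](cardsD1 a) aP.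
  - exact: block_familyS famP.
  - apply: leq_trans (_ : #|nb P b| <= _); first by apply/ltnW/degP.
    rewrite -nbE //; apply/subset_leq_card/subsetP=> Y.
    by case/setIdP.
  - by move=> X XP _; rewrite nbE //; case/setD1P: XP => Xa XP; apply: degP.
(* Contracting [y] into the root preserves the degree bound unless some common neighbour of both has
   degree 3. *)
have into_root y : y \in nb P a ->
    has_minor e (complete_graph 4) \/
    exists z, [/\ z \in P, a \in nb P z, y \in nb P z & #|nb P z| = 3].
  move=> ya; have [yP yna aay] := nbP _ _ ya.
  case: (boolP [exists z in P :\ a :\ y,
      [&& a \in nb P z, y \in nb P z & #|nb P z| <= 3]]) => [/exists_inP[z]|].
    case/setD1P=> zy /setD1P[zna zP] /and3P[az yz le3]; right; exists z; split=> //.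
    by apply/eqP; rewrite eqn_leq le3 degP.
  rewrite negb_exists_in => /forall_inP nz; left.
  have fam' := block_family_contract famP aP ya.
  have lt' := card_contract aP ya.
  have rP : a :|: y \in contract P a y by rewrite setU11.
  have deg' X : X \in P :\ a :\ y -> 3 <= #|nb (contract P a y) X|.
    move=> XP; have := nz X XP; rewrite andbA negb_and -ltnNge => /orP[nb2|lt3].
      apply: leq_trans (card_nb_contract famP aP ya XP nb2); apply: degP.
        by move: XP; rewrite !inE => /and3P[].
      by move: XP; rewrite !inE => /and3P[].
    exact: (card_nb_contract_pred famP aP ya XP lt3).
  apply: (IHn (contract P a y) (a :|: y)) => //.
  - exact: leq_trans leP.
  - rewrite (cardsD1 (a :|: y)) rP ltnS card_gt0.
    have : 3 <= #|nb P y| by apply: degP.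
    move=> /(ltn_cardsD1 a)/ltnW.
    case/card_gt0P=> z; rewrite !inE => /and4P[zna zP zy _].
    have zP' : z \in P :\ a :\ y by rewrite !inE zna zy zP.
    apply/set0Pn; exists z; rewrite in_setD1 (neq_contract famP aP ya zP') /=.
    by rewrite in_setU zP' orbT.
  - by move=> X /setU1P[->|XP]; [rewrite eqxx | move=> _; apply: deg'].
(* The obstruction [z] is itself a neighbour of the root, so the dichotomy applies to it again and
   yields [z']. *)
have [//|[z [zP az xz nbz3]]] := into_root x xa.
have za : z \in nb P a by rewrite nb_sym.
have [//|[z' [z'P az' zz' nbz'3]]] := into_root z za.
have [_ anz aaz] := nbP _ _ az; have [_ anz' aaz'] := nbP _ _ az'.
have [_ zNz' azz'] := nbP _ _ zz'.
have third b c d : b \in P -> #|nb P b| = 3 -> c \in nb P b -> d \in nb P b -> c != d ->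
    exists2 t, t \in nb P b & nb P b = [set c; d; t] /\ (t != c) && (t != d).
  move=> bP nb3 cb db cd.
  have /eqP/cards1P[t tE] : #|nb P b :\ c :\ d| = 1.
    move: nb3; rewrite (cardsD1 c) cb (cardsD1 d (_ :\ c)) in_setD1 eq_sym cd db.
    by case.
  have : t \in nb P b :\ c :\ d by rewrite tE set11.
  rewrite !in_setD1 => /and3P[td tc tb]; exists t => //; split; last by rewrite td tc.
  apply/setP=> Y; have /setP/(_ Y) := tE; rewrite !in_setU !in_setD1 !in_set1.
  have [->|_ /=] := eqVneq Y c; first by rewrite cb.
  by have [->|_ /=] := eqVneq Y d; first by rewrite db.
have z'z : z' \in nb P z by rewrite nb_sym.
have [t tz [nbz /andP[tna tnz']]] := third z a z' zP nbz3 az z'z anz'.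
have [t' tz' [nbz' /andP[t'na t'nz]]] := third z' a z z'P nbz'3 az' zz' anz.
have [tP tnz atz] := nbP _ _ tz; have [t'P t'nz' at'z'] := nbP _ _ tz'.
have [tt'|ntt'] := eqVneq t t'; last first.
  (* The merged block has the three neighbours [a], [t], [t']. Apart from the root, no block is
     adjacent to both [z] and [z'], so no other degree drops. *)
  have fam' := block_family_contract famP zP z'z.
  have keep X : X \in P -> X != z -> X != z' -> X \in contract P z z'.
    by move=> XP Xz Xz'; rewrite !inE XP Xz Xz' orbT.
  have zz'n X : X \in P -> X != z -> X != z' -> X != z :|: z'.
    by move=> XP Xz Xz'; apply: (neq_contract famP zP z'z); rewrite !inE XP Xz Xz'.
  apply: (IHn (contract P z z') a) => //.
  - exact: leq_trans (card_contract zP z'z) leP.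
  - exact: keep.
  - by apply/card_gt1P; exists a, (z :|: z'); rewrite keep // setU11 zz'n.
  move=> X /setU1P[-> _|XP Xa].
    apply/card_gt2P; exists a, t, t'; split; last by rewrite eq_sym tna ntt' t'na.
    rewrite ![_ \in nb _ _]inE !keep ?zz'n //= ![adj (_ :|: _) _]adj_sym !adjUr.
    by rewrite (adj_sym a) aaz (adj_sym t) atz (adj_sym t' z') at'z' orbT.
  have [[Xz' Xz] XP'] : (X != z' /\ X != z) /\ X \in P by move: XP; rewrite !inE => /and3P[].
  apply: leq_trans (card_nb_contract famP zP z'z XP _); first exact: degP.
  rewrite (nb_sym zP XP') (nb_sym z'P XP') nbz nbz' !inE.
  rewrite (negbTE Xa) (negbTE Xz) (negbTE Xz') /=.
  by apply: contra ntt' => /andP[/eqP<- /eqP<-].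
subst t'.
pose Q := P :\ a :\ z :\ z'.
have tQ : t \in Q by rewrite !inE tnz' tnz tna tP.
(* The component of [t] is obtained as an inclusion-maximal family of this kind. *)
pose good (D : {set {set T}}) := (t \in D) && (D \subset Q) && conn (cover D).
have good1 : good [set t].
  by rewrite /good set11 sub1set tQ /cover big_set1 cP.
have [D /maxsetP[/andP[/andP[tD DQ] cD] maxD] _] := maxset_exists good1.
have DP : D \subset P.
  by apply: subset_trans DQ _; rewrite !subDset; apply/subsetP=> Y YP; rewrite !inE YP !orbT.
have DQ' X : X \in D -> [/\ X != z', X != z, X != a & X \in P].
  by move/(subsetP DQ); rewrite !inE => /and4P.
have adjD X Y : X \in D -> adj Y X -> adj Y (cover D).
  move=> XD /adjP[u [v [uY vX euv]]]; apply/adjP; exists u, v; split=> //.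
  by apply/bigcupP; exists X.
have disD X : X \in P -> X \notin D -> [disjoint X & cover D].
  move=> XP XD; rewrite -setI_eq0; apply/eqP/setP=> u; rewrite !inE; apply/negP.
  case/andP=> uX /bigcupP[Y YD uY]; have : [disjoint X & Y].
    apply: dP => //; first by case/DQ': YD.
    by apply: contraNneq XD => ->.
  by move/disjointFr/(_ uX); rewrite uY.
have aD : a \notin D by apply/negP=> /DQ'[_ _]; rewrite eqxx.
have zD : z \notin D by apply/negP=> /DQ'[_]; rewrite eqxx.
have z'D : z' \notin D by apply/negP=> /DQ'[]; rewrite eqxx.
have [aaD|naD] := boolP (adj a (cover D)).
  apply: (@K4_minor_of_blocks a z z' (cover D)); first by rewrite /= cD !cP.
  rewrite /= !disD // !dP // 1?eq_sym // aaD (adj_sym a z) aaz (adj_sym a z') aaz'.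
  by rewrite (adj_sym z z') azz' (adjD t) // (adjD t).
(* The only way out of [D] is from [t] to [z] or [z'], whose neighbourhoods are known. Hence only
   [t] loses neighbours on restriction to [D], and it becomes the root. *)
have closed X Y : X \in D -> Y \in P -> adj X Y -> Y \in D \/ X = t /\ (Y = z \/ Y = z').
  move=> XD YP aXY; have [XNz' XNz Xa XP] := DQ' X XD.
  have [Ya|Ya] := eqVneq Y a.
    by case/negP: naD; apply: (adjD X) => //; rewrite -Ya adj_sym.
  have [Yz|Yz] := eqVneq Y z.
    have : X \in nb P z by rewrite inE XP XNz adj_sym -Yz.
    by rewrite nbz !inE (negbTE Xa) (negbTE XNz') => /eqP->; right; split=> //; left.
  have [Yz'|Yz'] := eqVneq Y z'.
    have : X \in nb P z' by rewrite inE XP XNz' adj_sym -Yz'.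
    by rewrite nbz' !inE (negbTE Xa) (negbTE XNz) => /eqP->; right; split=> //; right.
  left; have YQ : Y \in Q by rewrite !inE Yz' Yz Ya YP.
  rewrite -(maxD (Y |: D)) ?setU11 ?subsetUr // /good !inE tD orbT subUset sub1set YQ DQ /=.
  rewrite /cover bigcup_setU big_set1; apply: connU => //; first exact: cP.
  by apply: (adjD X) => //; rewrite adj_sym.
(* The degree of [t] leaves a neighbour besides [z] and [z'], so the smaller instance is not a
   single block. *)
have [r rD rt] : exists2 r, r \in D & r != t.
  have : 3 <= #|nb P t| by apply: degP.
  move=> /(ltn_cardsD1 z)/(ltn_cardsD1 z').
  case/card_gt0P=> r; rewrite !inE => /and5P[rz' rz rP rt art]; exists r => //.
  have [//|[_ [rE|rE]]] := closed t r tD rP art.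
    by rewrite rE eqxx in rz.
  by rewrite rE eqxx in rz'.
apply: (IHn D t) => //.
- apply: leq_trans leP; rewrite (cardsD1 a P) aP ltnS; apply: subset_leq_card.
  by rewrite subsetD1 DP.
- exact: block_familyS famP.
- by apply/card_gt1P; exists r, t.
move=> X XD Xt; have [_ _ Xa XP] := DQ' X XD.
apply: leq_trans (degP X XP Xa) _; apply/subset_leq_card/subsetP=> Y YX.
have [YP YnX aXY] := nbP _ _ YX; rewrite inE YnX aXY !andbT.
by have [|[XE _]] := closed X Y XD YP aXY; last by rewrite XE eqxx in Xt.
Qed.

End BlockFamilies.

(** * Minimal dominating families of neighbourhoods *)

Section SmallDominator.

Variables (T : finType) (e : rel T) (U W : {set T}).
Hypotheses (simple_e : simple_graph e) (bip : bipartition e U W).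

Let e_sym : symmetric e. Proof. by case: simple_e. Qed.

Definition nbhd (x : T) : {set T} := [set y | e x y].

(** The antichain condition has two uses: it excludes degrees below 2 in [D], and it prevents two
    contracted vertices from producing parallel edges. *)
Lemma K4_minor_of_antichain (D : {set T}) :
  D \subset U ->
  {in D &, forall u v, nbhd u \subset nbhd v -> u = v} ->
  (exists x y, x \in W /\ e x y) ->
  (forall x y, x \in W -> e x y -> 2 < #|nbhd x :&: D|) ->
  has_minor e (complete_graph 4).
Proof.
move=> /subsetP DU anti [x0 [y0 [x0W ex0]]] deg3.
have nbhdW u w : u \in D -> e u w -> w \in W.
  by move=> /DU uU /(bipartition_edge bip) <-.
have UNW u : u \in D -> u \notin W by move/DU/(bipartition_notinW bip).
have gt2 x y : x \in W -> e x y -> forall u, exists2 v, v \in D & e x v /\ v != u.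
  move=> xW exy u; have /(ltn_cardsD1 u)/ltnW/card_gt0P[v] := deg3 x y xW exy.
  by rewrite !inE => /and3P[vu exv vD]; exists v.
(* A neighbourhood with at most one element would lie inside that of another vertex of [D], supplied
   by [gt2]. *)
have deg2 u : u \in D -> 1 < #|nbhd u|.
  move=> uD; rewrite ltnNge; apply/negP=> le1.
  suff [v vD [uv vu]] : exists2 v, v \in D & nbhd u \subset nbhd v /\ v != u.
    by rewrite (anti u v) ?eqxx in vu.
  have [u0|[w]] := set_0Vmem (nbhd u).
    by have [v vD [_ vu]] := gt2 _ _ x0W ex0 u; exists v; rewrite // u0 sub0set.
  rewrite inE => euw.
  have [v vD [ewv vu]] := gt2 w u (nbhdW u w uD euw) (etrans (e_sym _ _) euw) u.
  exists v => //; split=> //; apply/subsetP=> x; rewrite !inE => eux.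
  have /card_le1P/(_ w) := le1; rewrite inE => /(_ euw x); rewrite !inE eux => /esym/eqP->.
  by rewrite e_sym.
(* The default is never reached on [D], by [deg2]. *)
pose c u := odflt u [pick x in nbhd u].
have ec u : u \in D -> e u (c u).
  move=> uD; rewrite /c; case: pickP => [x|u0] /=; first by rewrite inE.
  by have := deg2 u uD; rewrite eq_card0.
pose low := [set u in D | #|nbhd u| == 2].
pose f x := if x \in low then c x else x.
(* Since [f] fixes [V], its fibres over [V] are disjoint; each is a star centred at its index. *)
pose blk v := [set x in D :|: W | f x == v].
pose V := [set w in W | nbhd w != set0] :|: [set u in D | 2 < #|nbhd u|].
have fV v : v \in V -> f v = v.
  rewrite /f !inE; case: ifP => // /andP[vD /eqP->].
  by rewrite (negbTE (UNW v vD)) ltnn andbF.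
have vblk v : v \in V -> v \in blk v.
  move=> vV; rewrite inE fV // eqxx andbT; move: vV; rewrite !inE.
  by case/orP=> /andP[-> _]; rewrite ?orbT.
have blk_inj : {in V &, injective blk}.
  move=> v w vV wV /setP/(_ v); rewrite vblk // => /esym; rewrite inE fV // => /andP[_].
  by move/eqP.
have WV w u : w \in W -> e w u -> w \in V.
  move=> wW ewu; rewrite !inE wW; case: eqVneq => // w0.
  by have := in_set0 u; rewrite -w0 inE ewu.
pose P := blk @: V.
have famP : block_family e P.
  split=> [_ /imsetP[v vV ->]|_ _ /imsetP[v vV ->] /imsetP[w wV ->] vw].
    apply: (conn_star e_sym (vblk v vV)) => x; rewrite inE /f; case: ifP => [xl|_] /andP[_ /eqP<-].
      by right; rewrite e_sym ec //; case/setIdP: xl.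
    by left.
  rewrite -setI_eq0; apply/eqP/setP=> x; rewrite !inE; apply/negP.
  by case/andP=> /andP[_ /eqP xv] /andP[_ /eqP xw]; case/eqP: vw; rewrite -xv -xw.
have nbblk v w x y : v \in V -> w \in V -> v != w -> x \in blk v -> y \in blk w -> e x y ->
    blk w \in nb e P (blk v).
  move=> vV wV vw xv yw exy; rewrite inE imset_f //=.
  rewrite (inj_in_eq blk_inj) // eq_sym vw; apply/adjP; by exists x, y.
have degP X : X \in P -> 2 < #|nb e P X|.
  case/imsetP=> v vV ->; move: (vV); rewrite in_setU => /orP[|]; rewrite in_set => /andP[].
    move=> vW /set0Pn[y]; rewrite in_set => evy.
    (* [g u] is the vertex of the contracted graph reached from [v] through [u]: the other neighbour
       of [u] if [u] is contracted, and [u] itself otherwise. *)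
    pose g u := if u \in low then odflt u [pick x in nbhd u :\ v] else u.
    have glow u : u \in low -> e v u -> nbhd u = [set v; g u] /\ g u != v.
      move=> ul evu; rewrite /g ul; case/setIdP: ul => uD /cards2P[p [q [pq uE]]].
      have vu : v \in nbhd u by rewrite inE e_sym.
      case: pickP => [x|none] /=.
        rewrite uE !inE => /andP[xv xpq]; split=> //; move: vu; rewrite uE !inE.
        case/orP=> /eqP E; subst v; case/orP: xpq => /eqP E; subst x => //.
        - by rewrite eqxx in xv.
        - by rewrite setUC.
        - by rewrite eqxx in xv.
      move: (none p) (none q); rewrite uE !inE !eqxx orbT !andbT => /negbFE/eqP pv /negbFE/eqP qv.
      by rewrite pv qv eqxx in pq.
    have gV u : u \in D -> e v u -> g u \in V.
      move=> uD evu; have [ul|ul] := boolP (u \in low).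
        have [uE _] := glow u ul evu; have : g u \in nbhd u by rewrite uE !inE eqxx orbT.
        by rewrite inE => eug; apply: (WV _ u); rewrite 1?e_sym // (nbhdW u).
      have u2 : #|nbhd u| != 2 by move: ul; rewrite inE uD.
      by rewrite /g (negbTE ul) in_setU !in_set uD ltn_neqAle (eq_sym 2) u2 deg2 ?orbT.
    (* Equal images are both in [W] or both in [D]. In the first case [u] and [u'] have the same two
       neighbours, so the antichain condition identifies them. *)
    have ginj : {in nbhd v :&: D &, injective (blk \o g)}.
      move=> u u'; rewrite !in_setI !(in_set (e v)) => /andP[evu uD] /andP[evu' u'D] /= guu'.
      have {}guu' := blk_inj _ _ (gV u uD evu) (gV u' u'D evu') guu'.
      have gW x : x \in D -> e v x -> (g x \in W) = (x \in low).
        move=> xD evx; have [xl|xl] := boolP (x \in low); last first.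
          by rewrite /g (negbTE xl) (negbTE (UNW x xD)).
        have [xE _] := glow x xl evx; apply: (nbhdW x) => //.
        have : g x \in nbhd x by rewrite xE !inE eqxx orbT.
        by rewrite inE.
      have := gW u uD evu; rewrite guu' gW // => lE; have [ul|ul] := boolP (u \in low).
        have [uE _] := glow u ul evu; rewrite -lE in ul; have [u'E _] := glow u' ul evu'.
        by apply: anti; rewrite // uE u'E guu'.
      by move: guu'; rewrite /g lE (negbTE ul).
    apply: leq_trans (deg3 v y vW evy) _; rewrite -(card_in_imset ginj).
    apply/subset_leq_card/subsetP=> Y /imsetP[u /setIP[]]; rewrite in_set => evu uD -> /=.
    have [ul|ul] := boolP (u \in low); last first.
      have gu : g u = u by rewrite /g (negbTE ul).
      have uV : u \in V by rewrite -gu gV.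
      rewrite gu; apply: (nbblk v u v u) => //; try exact: vblk.
      by apply: contraTneq vW => ->; apply: UNW.
    have [uE gv] := glow u ul evu; have guV := gV u uD evu.
    have fu : f u = c u by rewrite /f ul.
    have : c u \in nbhd u by rewrite inE ec.
    have eug : e u (g u).
      have : g u \in nbhd u by rewrite uE !inE eqxx orbT.
      by rewrite inE.
    (* Depending on which neighbour absorbed [u], the edge between the two blocks is [u] to [g u] or
       [v] to [u]. *)
    rewrite uE in_set2 => /orP[]/eqP cu.
      by apply: (nbblk v (g u) u (g u)) => //; rewrite 1?eq_sym ?vblk // in_set in_setU uD fu cu /=.
    by apply: (nbblk v (g u) v u) => //; rewrite 1?eq_sym ?vblk // in_set in_setU uD fu cu /=.
  move=> vD v3; apply: leq_trans v3 _.
  have subV : {subset nbhd v <= V}.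
    by move=> w; rewrite in_set => evw; apply: (WV _ v); rewrite 1?e_sym // (nbhdW v).
  rewrite -(card_in_imset (sub_in2 subV blk_inj)).
  apply/subset_leq_card/subsetP=> _ /imsetP[w wv ->]; have wV := subV w wv.
  rewrite in_set in wv; apply: (nbblk v w v w) => //; try exact: vblk.
  by apply: contraTneq (nbhdW v w vD wv) => <-; apply: UNW.
have x0V : x0 \in V by apply: WV ex0.
have bP : blk x0 \in P by apply: imset_f.
(* All blocks have degree at least 3, so any of them can serve as root. *)
apply: (K4_minor_of_rooted_min_degree e_sym famP bP) => [|X XP _]; last exact: degP.
apply: leq_trans (ltnW (degP _ bP)) _; apply/subset_leq_card/subsetP=> Y.
by case/setIdP.
Qed.

Lemma exists_in_at_most_half :
  series_parallel e -> (exists x y, e x y) -> exists2 u, u \in U & in_at_most_half e u.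
Proof.
move=> sp [x [y exy]].
pose dom (D : {set T}) :=
  (D \subset U) && [forall u in U, exists v in D, nbhd u \subset nbhd v].
have domU : dom U.
  by rewrite /dom subxx; apply/forall_inP=> u uU; apply/exists_inP; exists u.
have [D /minsetP[/andP[DU /forall_inP domD] minD] _] := minset_exists domU.
(* If [v] dominated a different [u], then [D :\ u] would still dominate, against minimality. *)
have anti : {in D &, forall u v, nbhd u \subset nbhd v -> u = v}.
  move=> u v uD vD uv; apply/eqP/negPn/negP=> nuv.
  have : dom (D :\ u).
    rewrite /dom (subset_trans (subD1set D u) DU); apply/forall_inP=> s sU.
    have /exists_inP[s' s'D ss'] := domD s sU; apply/exists_inP.
    have [E|ns'] := eqVneq s' u; last by exists s'; rewrite // !inE ns'.
    by exists v; rewrite ?inE 1?eq_sym ?nuv // (subset_trans ss') // E.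
  by move/minD=> /(_ (subD1set D u)) E; move: uD; rewrite -E !inE eqxx.
have [w [u [wW ewu]]] : exists w u, w \in W /\ e w u.
  case/orP: (bipartition_cover bip x) => [xU|xW]; last by exists x, y.
  by exists y, x; rewrite -(bipartition_edge bip exy) e_sym.
case: (boolP [exists w in W, (nbhd w != set0) && (#|nbhd w :&: D| <= 2)]); last first.
  rewrite negb_exists_in => /forall_inP small; case: sp.
  apply: (K4_minor_of_antichain DU anti); first by exists w, u.
  move=> a b aW eab; have := small a aW; rewrite negb_and negbK -ltnNge => /orP[/eqP a0|//].
  by have := in_set0 b; rewrite -a0 inE eab.
case/exists_inP=> v vW /andP[/set0Pn[s]]; rewrite inE => evs le2.
(* The member of [D] that dominates [a] inherits both [v] and [b] as neighbours. *)
have toD a b : e v a -> e a b -> exists2 d, d \in nbhd v :&: D & e d b.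
  move=> eva eab; have aU : a \in U by rewrite (bipartition_edge bip (y := v)) // e_sym.
  have /exists_inP[d dD /subsetP ad] := domD a aU; exists d; last first.
    by have := ad b; rewrite !inE; apply.
  by rewrite !inE dD andbT e_sym; have := ad v; rewrite !inE e_sym; apply.
have [y1 y1D _] := toD s v evs (etrans (e_sym _ _) evs).
have [y2 y2D cover2] : exists2 y2, y2 \in nbhd v :&: D & nbhd v :&: D \subset [set y1; y2].
  have [E|[y2 /setD1P[y21 y2D]]] := set_0Vmem ((nbhd v :&: D) :\ y1).
    (* With a single neighbour in [D], [y2] is taken equal to [y1]. *)
    by exists y1 => //; rewrite setUid -setD_eq0 E.
  exists y2 => //; apply/subsetP=> z zD; rewrite !inE.
  have [//|zy1] := eqVneq z y1; have [//|zy2] := eqVneq z y2.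
  suff : 2 < #|nbhd v :&: D| by rewrite ltnNge le2.
  by apply/card_gt2P; exists y1, y2, z; rewrite y1D y2D zD zy1 eq_sym y21 eq_sym zy2.
have NvU z : z \in nbhd v :&: D -> e v z /\ z \in U.
  by rewrite inE inE => /andP[evz /(subsetP DU)].
have [[ev1 y1U] [ev2 y2U]] := (NvU _ y1D, NvU _ y2D).
have [||] := in_at_most_half_dominating simple_e bip vW ev1 ev2.
- move=> a b eva eab; have [d dD edb] := toD a b eva eab.
  by have /set2P[<-|<-] := subsetP cover2 d dD; rewrite edb ?orbT.
- by exists y1.
- by exists y2.
Qed.

End SmallDominator.

Theorem theorem17 (T : finType) (e : rel T) (U W : {set T}) :
  simple_graph e ->
  bipartition e U W ->
  series_parallel e ->
  satisfies_Frankl e U W.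
Proof.
move=> sg bip sp edge; split; first exact: (exists_in_at_most_half sg bip).
(* The other side follows by exchanging the two classes. *)
apply: (@exists_in_at_most_half T e W U sg _ sp edge).
by case: bip => UW dUW sU sW; split; rewrite // 1?setUC // disjoint_sym.
Qed.
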